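(* Let $L\subset\mathbb{R}^n$ be compact with $L\subseteq B_R^n$ for a finite radius $R>0$. Then there is no relaxation gap between the slice-volume problem and its continuous-function linear program: $p^*=P^*$, where $$P^*=\sup_{\theta\in S^{n-1},\ t\in[-R,R]}\mathrm{Vol}_{n-1}\bigl(\{x\in L:\ \theta\cdot x=t\}\bigr)$$ and $p^*$ is the infimum of $\gamma$ over all $\gamma\in\mathbb{R}$ and $w\in C(\Psi)$ satisfying $$\gamma\ \ge\ \Lambda_R w(\theta,t,Z)\quad\forall(\theta,t,Z)\in\Omega_Z,\qquad w\ge 1\ \text{on }\Psi_L,\qquad w\ge 0\ \text{on }\Psi .$$
   Context: $n$ is a positive integer, $B_R^m=\{y\in\mathbb{R}^m:\|y\|_2\le R\}$, $S^{n-1}$ is the unit sphere of $\mathbb{R}^n$, $O(n)$ is the group of $n\times n$ orthogonal matrices, $\mathrm{Vol}_{n-1}$ is $(n-1)$-dimensional volume in the hyperplane $\theta\cdot x=t$, and $C(X)$ is the set of real continuous functions on $X$. Define $\Omega_Z=\{(\theta,t,Z)\in S^{n-1}\times[-R,R]\times\mathbb{R}^{n\times(n-1)}:\ [\theta,Z]\in O(n)\}$, $\Psi=\Omega_Z\times B_R^{n-1}$ (points written $(\theta,t,Z,y)$), $\Psi_L=\{(\theta,t,Z,y)\in\Psi:\ \theta t+Zy\in L\}$, and $\Lambda_R w(\theta,t,Z)=\int_{B_R^{n-1}}w(\theta,t,Z,y)\,dy$. *)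

(* Defs.v *)
From HB Require Import structures.
From mathcomp Require Import all_boot all_order all_algebra.
From mathcomp Require Import all_classical all_reals all_analysis.
Set Implicit Arguments.
Unset Strict Implicit.
Unset Printing Implicit Defensive.
Import Order.TTheory GRing.Theory Num.Theory.
Import numFieldNormedType.Exports.
Local Open Scope classical_set_scope.
Local Open Scope ring_scope.

(* The norm `|x| that MathComp-Analysis puts on matrices is the sup norm, so
   the Euclidean norm is defined here; the topologies coincide. *)
Definition dot (R : realType) (n : nat) (u v : 'cV[R]_n) : R :=
  \sum_(i < n) u i ord0 * v i ord0.

Definition norm2 (R : realType) (n : nat) (x : 'cV[R]_n) : R :=
  Num.sqrt (dot x x).

Definition ball2 (R : realType) (n : nat) (r : R) : set 'cV[R]_n :=
  [set x | norm2 x <= r].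

Definition sphere2 (R : realType) (n : nat) : set 'cV[R]_n :=
  [set x | norm2 x = 1].

Definition orthogonal_group (R : realType) (n : nat) : set 'M[R]_n :=
  [set A | A^T *m A = 1%:M].

Section cons_measure.
Context d (T : measurableType d) (R : realType) (m : nat).
Variables (nu : {sigma_finite_measure set T -> \bar R})
  (mu : {sigma_finite_measure set (m.-tuple T) -> \bar R}).

Definition cons_pair (p : T * m.-tuple T) : m.+1.-tuple T :=
  [the m.+1.-tuple T of p.1 :: p.2].

Lemma measurable_cons_pair : measurable_fun [set: T * m.-tuple T] cons_pair.
Proof. exact: measurable_cons. Qed.

#[local] Hint Resolve measurable_cons_pair : core.

Definition cons_measure : set (m.+1.-tuple T) -> \bar R :=
  pushforward (nu \x mu)%E cons_pair.

Let cons_measure0 : cons_measure set0 = 0%E.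
Proof. exact: measure0. Qed.

Let cons_measure_ge0 A : (0 <= cons_measure A)%E.
Proof. exact: measure_ge0. Qed.

Let cons_measure_sigma_additive : semi_sigma_additive cons_measure.
Proof. exact: measure_semi_sigma_additive. Qed.

HB.instance Definition _ := isMeasure.Build _ _ _ cons_measure
  cons_measure0 cons_measure_ge0 cons_measure_sigma_additive.

Let cons_measure_sigma_finite : sigma_finite setT cons_measure.
Proof.
have /sigma_finiteP[F [FT ndF Foo]] := sigma_finiteT nu.
have /sigma_finiteP[G [GT ndG Goo]] := sigma_finiteT mu.
pose uncons (t : m.+1.-tuple T) : T * m.-tuple T :=
  (thead t, [tuple of behead t]).
have muncons : measurable_fun [set: m.+1.-tuple T] uncons.
  apply/measurable_fun_pair; last exact: measurable_behead.
  exact: measurable_tnth.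
have consK : uncons \o cons_pair = id.
  by apply/funext => -[x t]; congr pair => //; exact/val_inj.
exists (fun k => uncons @^-1` (F k `*` G k)).
  apply/esym; rewrite -subTset => t _.
  have [i _ Fi] : (\bigcup_k F k) (thead t) by rewrite -FT.
  have [j _ Gj] : (\bigcup_k G k) [tuple of behead t] by rewrite -GT.
  exists (maxn i j) => //; split => /=.
  - by move: (thead t) Fi; exact/subsetPset/ndF/leq_maxl.
  - by move: [tuple of behead t] Gj; exact/subsetPset/ndG/leq_maxr.
move=> k; have [mF Fk] := Foo k; have [mG Gk] := Goo k; split.
  by rewrite -[X in measurable X]setTI; apply: muncons => //; exact: measurableX.
rewrite /cons_measure /pushforward -comp_preimage consK.
rewrite (_ : id @^-1` _ = F k `*` G k)// product_measure1E//.
by rewrite lte_mul_pinfty// ge0_fin_numE.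
Qed.

HB.instance Definition _ := Measure_isSigmaFinite.Build _ _ _ cons_measure
  cons_measure_sigma_finite.

End cons_measure.

(* Lebesgue measure on R^m, with R^m carried by m-tuples (whose sigma-algebra
   is the library's product one): the Dirac mass on the point R^0, and then
   iterated products with the one-dimensional Lebesgue measure. *)
Fixpoint lebesgue_tuple (R : realType) (m : nat) :
    {sigma_finite_measure set (m.-tuple (measurableTypeR R)) -> \bar R} :=
  match m with
  | 0 => [the {sigma_finite_measure set _ -> \bar R} of
            dirac ([tuple] : 0.-tuple (measurableTypeR R))]
  | m'.+1 => [the {sigma_finite_measure set _ -> \bar R} of
            cons_measure (@lebesgue_measure R) (lebesgue_tuple R m')]
  end.

Definition col_of_tuple (R : realType) (m : nat)
    (y : m.-tuple (measurableTypeR R)) : 'cV[R]_m := \col_i tnth y i.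

(* Throughout, m stands for n - 1, so that the ambient dimension n = m.+1 is
   positive. *)
Section slices.
Variables (R : realType) (m : nat).
Implicit Types (theta x : 'cV[R]_m.+1) (t r : R) (Z : 'M[R]_(m.+1, m)).

Definition frame theta : set 'M[R]_(m.+1, m) :=
  [set Z | orthogonal_group (row_mx theta Z : 'M[R]_m.+1)].

(* m-dimensional volume of the part of A in the hyperplane theta . x = t, for a
   unit vector theta: Lebesgue measure on R^m carried over by the isometry
   y |-> t theta + Z y of R^m onto the hyperplane, for a chosen orthonormal
   basis Z of the orthogonal complement of theta. The value does not depend on
   the choice, by rotation invariance of Lebesgue measure. *)
Definition hyperplane_vol theta t (A : set 'cV[R]_m.+1) : \bar R :=
  lebesgue_tuple R m
    [set y | A (t *: theta + xget 0 (frame theta) *m col_of_tuple y)].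

Definition slice (L : set 'cV[R]_m.+1) theta t : set 'cV[R]_m.+1 :=
  [set x | L x /\ dot theta x = t].

Definition Pstar (r : R) (L : set 'cV[R]_m.+1) : \bar R :=
  ereal_sup [set hyperplane_vol p.1 p.2 (slice L p.1 p.2)
            | p in @sphere2 R m.+1 `*` `[- r, r]%classic].

Definition OmegaZ (r : R) : set ('cV[R]_m.+1 * R * 'M[R]_(m.+1, m)) :=
  [set p | [/\ sphere2 p.1.1, - r <= p.1.2 <= r & frame p.1.1 p.2]].

Definition Psi (r : R) :
    set ('cV[R]_m.+1 * R * 'M[R]_(m.+1, m) * 'cV[R]_m) :=
  OmegaZ r `*` ball2 r.

Definition PsiL (r : R) (L : set 'cV[R]_m.+1) :
    set ('cV[R]_m.+1 * R * 'M[R]_(m.+1, m) * 'cV[R]_m) :=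
  Psi r `&` [set q | L (q.1.1.2 *: q.1.1.1 + q.1.2 *m q.2)].

Definition Lambda (r : R)
    (w : 'cV[R]_m.+1 * R * 'M[R]_(m.+1, m) * 'cV[R]_m -> R)
    (p : 'cV[R]_m.+1 * R * 'M[R]_(m.+1, m)) : \bar R :=
  (\int[lebesgue_tuple R m]_(y in [set y | ball2 r (col_of_tuple y)])
     (w (p, col_of_tuple y))%:E)%E.

(* An element of C(Psi) is represented by a total function that is continuous
   on the subspace Psi; its values outside Psi are never used. *)
Definition feasible (r : R) (L : set 'cV[R]_m.+1) (gamma : R)
    (w : 'cV[R]_m.+1 * R * 'M[R]_(m.+1, m) * 'cV[R]_m -> R) : Prop :=
  [/\ {within Psi r, continuous w},
      forall p, OmegaZ r p -> (Lambda r w p <= gamma%:E)%E,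
      forall q, PsiL r L q -> 1 <= w q &
      forall q, Psi r q -> 0 <= w q].

Definition pstar (r : R) (L : set 'cV[R]_m.+1) : \bar R :=
  ereal_inf [set gamma%:E | gamma in
    [set gamma : R | exists w, feasible r L gamma w]].

End slices.

(* Main.v *)
From HB Require Import structures.
Require Import Defs.
From mathcomp Require Import all_boot all_order all_algebra.
From mathcomp Require Import all_classical all_reals all_analysis.
From mathcomp Require Import measurable_realfun ring lra.
Import Order.TTheory GRing.Theory Num.Theory.
Import numFieldNormedType.Exports.
Local Open Scope classical_set_scope.
Local Open Scope ring_scope.

(** For feasible [(gamma, w)], [w] dominates the indicator of [L] on each slice,
    whence [Pstar <= gamma]. Conversely, take [w] to be a Urysohn function of
    the point [theta t + Z y] that is 1 on [L] and 0 off the open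
    [e]-neighbourhood of [L]; then [Lambda w] is at most the volume of the slab
    of [y] whose point lies in that neighbourhood. As [e] tends to 0 the slabs
    shrink to the slice of the compact [L], and a slab at a nearby parameter is
    contained in a slab of twice the width, so compactness of [OmegaZ] yields one
    [e] for which all slab volumes are below any prescribed [gamma > Pstar].
    Since [Pstar] uses one frame [Z] per [theta], this needs the rotation
    invariance of Lebesgue measure, obtained from its translation invariance. *)

Set Implicit Arguments.
Unset Strict Implicit.
Unset Printing Implicit Defensive.

(** * Columns as tuples; translation invariance on the line *)

Section tuple_measure.
Context {R : realType}.
Local Notation Rm m := (m.-tuple (measurableTypeR R)).
Local Notation mu m := (lebesgue_tuple R m).

Definition tuple_of_col m (v : 'cV[R]_m) : Rm m := [tuple v i ord0 | i < m].

Lemma tuple_of_colK m : cancel (@tuple_of_col m) (@col_of_tuple R m).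
Proof. by move=> v; apply/colP => i; rewrite mxE tnth_mktuple. Qed.

Lemma measurable_tuple_of_col d (T : measurableType d) m (f : T -> 'cV[R]_m) :
  (forall i, measurable_fun setT (fun z => f z i ord0 : measurableTypeR R)) ->
  measurable_fun setT (fun z => tuple_of_col (f z)).
Proof.
move=> mf; apply/measurable_fun_tnthP => i.
rewrite (_ : _ \o _ = fun z => f z i ord0) //.
by apply/funext => z /=; rewrite tnth_mktuple.
Qed.

Lemma measurable_coord d (T : measurableType d) m (f : T -> Rm m) i :
  measurable_fun setT f ->
  measurable_fun setT (fun z => col_of_tuple (f z) i ord0 : measurableTypeR R).
Proof.
move=> mf; under eq_fun do rewrite mxE.
by apply: (measurableT_comp (measurable_tnth i) mf).
Qed.

Lemma measurable_affine d (T : measurableType d) m (U : 'M[R]_m)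
    (f g : T -> Rm m) :
  measurable_fun setT f -> measurable_fun setT g ->
  measurable_fun setT
    (fun z => tuple_of_col (col_of_tuple (f z) + U *m col_of_tuple (g z))).
Proof.
move=> mf mg; apply: measurable_tuple_of_col => i.
under eq_fun do rewrite mxE [X in _ + X]mxE.
apply: measurable_funD; first exact: measurable_coord.
apply: measurable_sum => k; apply: measurable_funM => //.
exact: measurable_coord.
Qed.

(** The pushforward under the translation agrees with Lebesgue measure on half-open intervals, and
    these determine the measure. *)
Lemma lebesgue_measure_translation (b : R) (A : set (measurableTypeR R)) :
  measurable A ->
  lebesgue_measure ((fun x => b + x) @^-1` A) = lebesgue_measure A.
Proof.
move=> mA.
have mb : measurable_fun setT
    ((fun x => b + x) : measurableTypeR R -> measurableTypeR R).
  by apply: measurable_funD.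
pose f := (fun x => b + x) : measurableTypeR R -> measurableTypeR R.
pose mf_mixin := isMeasurableFun.Build _ _ _ _ f mb.
pose mf : {mfun measurableTypeR R >-> measurableTypeR R} := HB.pack f mf_mixin.
rewrite -[LHS]/(pushforward lebesgue_measure mf A).
apply/esym/lebesgue_measure_unique => //= _ [[x y]] _ <-.
rewrite /pushforward /= /f.
rewrite (_ : _ @^-1` _ = `]x - b, y - b]%classic); last first.
  by apply/seteqP; split => z /=; rewrite !in_itv /= ltrBlDl lerBrDl.
rewrite !lebesgue_measure_itv/= !lte_fin ltrD2r.
by case: ifP => // _; rewrite -!EFinB; congr (_%:E); ring.
Qed.
End tuple_measure.

(** * Translation invariance in dimension [m], and the measure of cubes *)

Section tuple_translation.
Context {R : realType}.
Local Notation Rm m := (m.-tuple (measurableTypeR R)).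
Local Notation mu m := (lebesgue_tuple R m).
Local Notation "x ::: y" := (@cons_pair _ (measurableTypeR R) _ (x, y)) (at level 60).

Lemma measurable_preimage d1 d2 (T1 : measurableType d1) (T2 : measurableType d2)
    (f : T1 -> T2) (A : set T2) :
  measurable_fun setT f -> measurable A -> measurable (f @^-1` A).
Proof. by move=> mf mA; rewrite -[_ @^-1` _]setTI; exact: mf. Qed.

(** The product measure is by construction the integral of the measures of the sections; this form
    drives the inductions on the dimension. *)
Lemma lebesgue_tupleS m (A : set (Rm m.+1)) : measurable A ->
  mu m.+1 A = (\int[lebesgue_measure]_x mu m [set y | A (x ::: y)])%E.
Proof.
move=> mA; apply: eq_integral => x _ /=; congr (mu m _).
by apply/seteqP; split => y /=; rewrite xsectionE.
Qed.

Lemma measurable_cons_section m (A : set (Rm m.+1)) x : measurable A ->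
  measurable [set y : Rm m | A (x ::: y)].
Proof.
move=> mA; apply: (measurable_preimage (f := fun y => x ::: y)) mA.
exact: (measurableT_comp (@measurable_cons_pair _ (measurableTypeR R) m)
  (pair1_measurable (x : measurableTypeR R))).
Qed.

Lemma measurable_fun_cons_section m (A : set (Rm m.+1)) : measurable A ->
  measurable_fun setT (fun x : measurableTypeR R => mu m [set y | A (x ::: y)]).
Proof.
move=> mA.
have mc : measurable (@cons_pair _ (measurableTypeR R) m @^-1` A).
  by apply: measurable_preimage mA; exact: measurable_cons_pair.
rewrite (_ : (fun _ => _) =
    mu m \o xsection (@cons_pair _ (measurableTypeR R) m @^-1` A)).
  exact: measurable_fun_xsection.
apply/funext => x /=; congr (mu m _).
by apply/seteqP; split => y /=; rewrite xsectionE.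
Qed.

Lemma ge0_integral_translation (b : R) (f : measurableTypeR R -> \bar R) :
  measurable_fun setT f -> (forall x, 0 <= f x)%E ->
  (\int[lebesgue_measure]_x f (b + x)%R = \int[lebesgue_measure]_x f x)%E.
Proof.
move=> mf f0.
have mb : measurable_fun setT
    ((fun x => b + x) : measurableTypeR R -> measurableTypeR R).
  by apply: measurable_funD.
have := @ge0_integral_pushforward _ _ _ _ _ _ mb lebesgue_measure setT f
  measurableT mf (fun x _ => f0 x).
rewrite preimage_setT => <-.
apply: eq_measure_integral => A mA _.
exact: lebesgue_measure_translation.
Qed.

(** Induction on the dimension: the induction hypothesis translates each section, and invariance of
    the outer integral translates the first coordinate. *)
Lemma lebesgue_tuple_add m (b : Rm m) (A : set (Rm m)) : measurable A ->
  mu m [set y | A [tuple tnth b i + tnth y i | i < m]] = mu m A.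
Proof.
elim: m b A => [|m IHm] b A mA.
  congr (mu 0%N _); apply/seteqP; split => y /=.
    by rewrite (tuple0 y) [X in A X](tuple0 _).
  by rewrite (tuple0 y) [X in _ -> A X](tuple0 _).
have mB : measurable [set y : Rm m.+1 | A [tuple tnth b i + tnth y i | i < m.+1]].
  apply: measurable_preimage mA; apply/measurable_fun_tnthP => i.
  rewrite (_ : _ \o _ = fun y : Rm m.+1 => tnth b i + tnth y i); last first.
    by apply/funext => y /=; rewrite tnth_mktuple.
  by apply: measurable_funD => //; exact: measurable_tnth.
rewrite !lebesgue_tupleS//.
rewrite -[RHS](ge0_integral_translation (thead b)); last 2 first.
- exact: measurable_fun_cons_section.
- by move=> x; exact: measure_ge0.
apply: eq_integral => x _.
rewrite -[RHS](IHm [tuple of behead b]); last exact: measurable_cons_section.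
congr (mu m _); apply: eq_set => y; congr A.
apply: eq_from_tnth => i; rewrite tnth_mktuple.
case: (unliftP ord0 i) => [j|] ->.
  rewrite !tnthS tnth_mktuple tnth_behead /=.
  rewrite (_ : inord j.+1 = lift ord0 j)//.
  by apply/val_inj; rewrite /= inordK// ltnS.
by [].
Qed.

Lemma lebesgue_tuple_translation m (v : 'cV[R]_m) (A : set (Rm m)) :
  measurable A ->
  mu m [set y | A (tuple_of_col (v + col_of_tuple y))] = mu m A.
Proof.
move=> mA; rewrite -[RHS](lebesgue_tuple_add (tuple_of_col v) mA).
congr (mu m _); apply: eq_set => y; congr A.
by apply: eq_from_tnth => i; rewrite !tnth_mktuple !mxE.
Qed.

Definition box m (c : R) : set (Rm m) := [set y | forall i, `|tnth y i| <= c].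

Lemma measurable_box m c : measurable (box c : set (Rm m)).
Proof.
rewrite (_ : box c = \bigcap_(i in [set: 'I_m]) [set y | `|tnth y i| <= c]); last first.
  by apply/seteqP; split => y H i; [move=> _|]; exact: H.
apply: fin_bigcap_measurable => // i _.
rewrite (_ : [set _ | _] = (fun y : Rm m => tnth y i) @^-1` `[- c, c]); last first.
  by apply/seteqP; split => y /=; rewrite in_itv/= ler_norml.
by apply: measurable_preimage; [exact: measurable_tnth|exact: measurable_itv].
Qed.

(** Cubes are products, so their measure is accessible by induction; they later bound Euclidean
    balls from inside and outside. *)
Lemma lebesgue_tuple_box m (c : R) : 0 < c ->
  (0 < mu m (box c) < +oo)%E.
Proof.
move=> c0; elim: m => [|m /andP[IH1 IH2]].
  rewrite /= diracE mem_set ?lte_fin ?ltr01 ?ltry// => -[] //.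
rewrite lebesgue_tupleS; last exact: measurable_box.
pose I : set (measurableTypeR R) := `[- c, c]%classic.
have -> : (\int[lebesgue_measure]_x mu m [set y | box c (x ::: y)] =
   (lebesgue_measure \x mu m) (I `*` box c))%E.
  apply: eq_integral => x _ /=; congr (mu m _).
  apply/seteqP; split => y /=; rewrite xsectionE /= /I /= in_itv/= -ler_norml.
    move=> H; split; first by have := H ord0; rewrite tnth0.
    by move=> i; have := H (lift ord0 i); rewrite tnthS.
  move=> [xc yc] i; case: (unliftP ord0 i) => [j|] ->; last by rewrite tnth0.
  by rewrite tnthS; exact: yc.
have mI : measurable I by exact: measurable_itv.
rewrite product_measure1E//; last exact: measurable_box.
rewrite [X in (X * _)%E](_ : _ = (c + c)%:E); last first.
  rewrite -[LHS]/(lebesgue_measure I).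
  by rewrite lebesgue_measure_itv/= lte_fin gtrN// -EFinB opprK.
apply/andP; split.
  by apply: mule_gt0; rewrite ?lte_fin// addr_gt0.
apply: lte_mul_pinfty => //; first by rewrite lee_fin addr_ge0// ltW.
Qed.
End tuple_translation.

(** * The Euclidean inner product *)

Section dot_lemmas.
Context {R : realType}.

Lemma dotE n (u v : 'cV[R]_n) : dot u v = (u^T *m v) ord0 ord0.
Proof. by rewrite mxE; apply: eq_bigr => i _; rewrite mxE. Qed.

Lemma dot_ge0 n (u : 'cV[R]_n) : 0 <= dot u u.
Proof. by apply: sumr_ge0 => i _; rewrite -expr2 sqr_ge0. Qed.

Lemma dotN n (u : 'cV[R]_n) : dot (- u) (- u) = dot u u.
Proof. by apply: eq_bigr => i _; rewrite mxE mulrNN. Qed.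

(** Trades the square root for a polynomial inequality, suited to measurability and to matrix
    algebra. *)
Lemma ball2E n (r : R) (x : 'cV[R]_n) : 0 <= r ->
  ball2 r x <-> dot x x <= r ^+ 2.
Proof.
move=> r0; rewrite /ball2 /= /norm2.
by rewrite -(ler_sqr (sqrtr_ge0 _))// sqr_sqrtr ?dot_ge0.
Qed.

Lemma sphere2E n (x : 'cV[R]_n) : sphere2 x <-> dot x x = 1.
Proof.
rewrite /sphere2 /= /norm2; split => [x1|->]; last by rewrite sqrtr1.
by rewrite -(sqr_sqrtr (dot_ge0 x)) x1 expr1n.
Qed.

Lemma dot_mulmx m n (Z : 'M[R]_(n, m)) (u : 'cV[R]_m) : Z^T *m Z = 1%:M ->
  dot (Z *m u) (Z *m u) = dot u u.
Proof.
by move=> ZZ; rewrite !dotE trmx_mul -mulmxA (mulmxA Z^T) ZZ mul1mx.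
Qed.

Lemma ball2_coord n (r : R) (x : 'cV[R]_n) i : 0 <= r -> ball2 r x -> `|x i ord0| <= r.
Proof.
move=> r0 /(ball2E _ r0) xr; rewrite -ler_sqr ?nnegrE// real_normK ?num_real//.
apply: le_trans xr; rewrite /dot (bigD1 i)//= -expr2 lerDl.
by apply: sumr_ge0 => j _; rewrite -expr2 sqr_ge0.
Qed.
End dot_lemmas.

(** * Rotation invariance of Lebesgue measure *)

Section rotation.
Context {R : realType}.
Local Notation Rm m := (m.-tuple (measurableTypeR R)).
Local Notation mu m := (lebesgue_tuple R m).

Definition tball m (r : R) : set (Rm m) := [set y | ball2 r (col_of_tuple y)].

Lemma measurable_tball m r : 0 <= r -> measurable (tball r : set (Rm m)).
Proof.
move=> r0.
pose f (y : Rm m) : measurableTypeR R := dot (col_of_tuple y) (col_of_tuple y).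
have mf : measurable_fun setT f.
  apply: measurable_sum => i.
  by apply: measurable_funM; apply: (measurable_coord (f := id)).
rewrite (_ : tball r = f @^-1` `]-oo, r ^+ 2]); last first.
  by apply/seteqP; split => y /=; rewrite in_itv/= => /(ball2E _ r0).
by apply: measurable_preimage mf _; exact: measurable_itv.
Qed.

Lemma lebesgue_tuple_tball m r : 0 < r -> (0 < mu m (tball r) < +oo)%E.
Proof.
move=> r0; have mB := @measurable_tball m _ (ltW r0).
apply/andP; split.
  (* A cube of this half-side fits in the ball because [m <= m.+1 ^ 2]; the successor keeps the
     half-side positive in dimension 0. *)
  have c0 : 0 < r / m.+1%:R by rewrite divr_gt0.
  have /andP[h _] := lebesgue_tuple_box m c0; apply: (lt_le_trans h).
  apply: le_measure; rewrite ?inE//; first exact: measurable_box.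
  move=> y yc; apply/(ball2E _ (ltW r0)).
  apply: (@le_trans _ _ (\sum_(i < m) (r / m.+1%:R) ^+ 2)).
    apply: ler_sum => i _; rewrite -expr2 !mxE -[leLHS]real_normK ?num_real//.
    by rewrite ler_sqr ?nnegrE// ?(ltW c0)//; exact: yc.
  rewrite sumr_const card_ord -[leLHS]mulr_natr expr_div_n -mulrA ler_piMr ?sqr_ge0//.
  rewrite mulrC ler_pdivrMr ?exprn_gt0// mul1r -natrX ler_nat.
  by rewrite (leq_trans (leqnSn m))// expnS leq_pmulr.
have /andP[_ h] := lebesgue_tuple_box m r0; apply: le_lt_trans h.
apply: le_measure; rewrite ?inE//; first exact: measurable_box.
by move=> y yr i; have := ball2_coord i (ltW r0) yr; rewrite mxE.
Qed.

Lemma measurable_linear m n (Z : 'M[R]_(n, m)) :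
  measurable_fun setT (fun y : Rm m => tuple_of_col (Z *m col_of_tuple y)).
Proof.
apply: measurable_tuple_of_col => i.
under eq_fun do rewrite mxE.
apply: measurable_sum => k; apply: measurable_funM => //.
exact: (measurable_coord (f := id)).
Qed.

(** Tonelli applied to the indicator of [S]. *)
Lemma lebesgue_tuple_fubini m1 m2 (S : set (Rm m1 * Rm m2)) : measurable S ->
  (\int[mu m1]_x mu m2 [set y | S (x, y)] = \int[mu m2]_y mu m1 [set x | S (x, y)])%E.
Proof.
move=> mS.
have mf : measurable_fun setT (EFin \o \1_S : Rm m1 * Rm m2 -> \bar R).
  by apply/measurable_EFinP.
have := @fubini_tonelli _ _ (Rm m1) (Rm m2) R (mu m1) (mu m2)
  (EFin \o \1_S) mf (fun x => _).
move=> H; transitivity (\int[mu m1]_x \int[mu m2]_y (EFin \o \1_S) (x, y))%E.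
  apply: eq_integral => x _.
  have mSx : measurable [set y | S (x, y)].
    apply: (measurable_preimage (f := fun y => (x, y))) mS.
    exact: pair1_measurable.
  rewrite -[X in mu m2 X]setIT -integral_indic//.
rewrite H; last by move=> z; rewrite /= lee_fin.
apply: eq_integral => y _.
have mSx : measurable [set x | S (x, y)].
  apply: (measurable_preimage (f := fun x => (x, y))) mS.
  exact: pair2_measurable.
rewrite -[X in mu m1 X]setIT -integral_indic//.
Qed.

(** Meant for the section measures in the rotation argument, constant on the unit ball and zero off
    it. The constant is an extended real since the set being rotated may have infinite measure. *)
Lemma integral_two_valued d (T : measurableType d) (nu : {measure set T -> \bar R})
    (D : set T) (c : \bar R) (f : T -> \bar R) :
  measurable D -> (0 <= c)%E -> (forall y, D y -> f y = c) ->
  (forall y, ~ D y -> f y = 0%E) -> (\int[nu]_y f y = c * nu D)%E.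
Proof.
move=> mD c0 fD fN.
rewrite (eq_integral (fun y => c * (\1_D y)%:E)%E); last first.
  move=> y _; rewrite indicE; have [yD|yD] := pselect (D y).
    by rewrite mem_set// mule1 fD.
  by rewrite memNset// mule0 fN.
rewrite ge0_integralZl// ?integral_indic ?setIT//.
by apply/measurable_EFinP; exact: measurable_indic.
Qed.

(* For the unit ball [B], [mu A * mu B] is the product measure of
   [{(x, y) | x + U y \in A, y \in B}]: translate [x] by [U y]. Translating [y]
   by [- U^T x] instead turns this set into [{(x, y) | U y \in A, y - U^T x \in B}],
   of measure [mu B * mu (U^-1 A)] because [y - U^T x \in B] iff [x - U y \in B]. *)
Lemma lebesgue_tuple_rotation m (U : 'M[R]_m) (A : set (Rm m)) :
  U^T *m U = 1%:M -> measurable A ->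
  mu m [set y | A (tuple_of_col (U *m col_of_tuple y))] = mu m A.
Proof.
move=> UU mA.
pose B : set (Rm m) := tball 1.
have mB : measurable B by exact: measurable_tball.
have /andP[B0 Boo] : (0 < mu m B < +oo)%E by exact: lebesgue_tuple_tball.
have mUA : measurable [set y : Rm m | A (tuple_of_col (U *m col_of_tuple y))].
  exact: measurable_preimage (measurable_linear U) mA.
(* The orthogonal [U] preserves the form and sends [y - U^T x] to [U y - x]; then change the
   sign. *)
have dotB (x y : 'cV[R]_m) :
    dot (y + - U^T *m x) (y + - U^T *m x) = dot (- (U *m y) + x) (- (U *m y) + x).
  rewrite -(dot_mulmx _ UU) mulmxDr mulmxA mulmxN (mulmx1C UU) mulNmx mul1mx.
  by rewrite -[RHS]dotN opprD opprK.
pose S1 : set (Rm m * Rm m) := [set z |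
  A (tuple_of_col (col_of_tuple z.1 + U *m col_of_tuple z.2)) /\ B z.2].
pose S2 : set (Rm m * Rm m) := [set z |
  A (tuple_of_col (U *m col_of_tuple z.2)) /\
  B (tuple_of_col (col_of_tuple z.2 + (- U^T) *m col_of_tuple z.1))].
have mS1 : measurable S1.
  apply: measurableI.
    by apply: measurable_preimage mA; exact: measurable_affine.
  exact: measurable_preimage mB.
have mS2 : measurable S2.
  apply: measurableI.
    by apply: (measurable_preimage (f := snd)) mUA.
  apply: measurable_preimage mB.
  by apply: (measurable_affine (- U^T) (f := snd) (g := fst)).
have e1 : (\int[mu m]_y mu m [set x | S1 (x, y)] = mu m A * mu m B)%E.
  apply: integral_two_valued => // y By.
    rewrite -[RHS](lebesgue_tuple_translation (U *m col_of_tuple y) mA).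
    by congr (mu m _); apply/seteqP; split => x; rewrite /S1 /= addrC => // -[].
  by rewrite -(measure0 (mu m)); congr (mu m _); apply/seteqP; split => x // -[].
have e2 : (\int[mu m]_x mu m [set y | S1 (x, y)] =
    \int[mu m]_x mu m [set y | S2 (x, y)])%E.
  apply: eq_integral => x _.
  rewrite -(lebesgue_tuple_translation ((- U^T) *m col_of_tuple x)); last first.
    apply: (measurable_preimage (f := fun y => (x, y))) mS1.
    exact: pair1_measurable.
  congr (mu m _); apply: eq_set => y; rewrite /S1 /S2 /= tuple_of_colK.
  rewrite mulmxDr mulmxA mulmxN (mulmx1C UU) [- 1%:M *m _]mulNmx.
  rewrite mul1mx addrA subrr add0r.
  by rewrite [in RHS]addrC.
have e3 : (\int[mu m]_y mu m [set x | S2 (x, y)] = mu m B *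
    mu m [set y | A (tuple_of_col (U *m col_of_tuple y))])%E.
  apply: integral_two_valued => // y By.
    rewrite -[RHS](lebesgue_tuple_translation (- (U *m col_of_tuple y)) mB).
    congr (mu m _); apply/seteqP.
    rewrite /S2 /B /tball /=.
    by split => x /= => [[_]|]; rewrite !tuple_of_colK => /(ball2E _ ler01) xB;
      [|split => //]; apply/(ball2E _ ler01); move: xB; rewrite dotB.
  by rewrite -(measure0 (mu m)); congr (mu m _); apply/seteqP; split => x // -[].
have : (mu m B * mu m [set y | A (tuple_of_col (U *m col_of_tuple y))] =
    mu m B * mu m A)%E.
  by rewrite -e3 [RHS]muleC -e1 -!lebesgue_tuple_fubini// e2.
(* The factor [mu m B] is positive and finite, hence can be cancelled even if [mu m A] is
   infinite. *)
have fB : mu m B \is a fin_num by rewrite ge0_fin_numE// ltW.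
move=> e; apply/eqP; rewrite eq_le.
rewrite -[X in X && _](lee_pmul2l fB B0) -[X in _ && X](lee_pmul2l fB B0).
by rewrite e lexx.
Qed.
End rotation.

(** * Borel sets of columns are measurable for the product sigma-algebra on tuples *)

Section borel.
Context {R : realType}.
Local Notation Rm m := (m.-tuple (measurableTypeR R)).

Lemma measurable_col_ball m (q : 'cV[R]_m) e :
  measurable (@col_of_tuple R m @^-1` ball q e).
Proof.
(* A ball of nonpositive radius is empty, whereas for [m = 0] the intersection over coordinates used
   below is the whole space. *)
have [e0|e0] := ltP 0 e; last first.
  rewrite (_ : _ @^-1` _ = set0)//; apply/seteqP; split => // y [] /=.
  by rewrite ltNge e0.
rewrite (_ : _ @^-1` _ = \bigcap_(i in [set: 'I_m])
    [set y | ball (q i ord0) e (tnth y i)]); last first.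
  apply/seteqP; split => y.
    by move=> [_ h] i _ /=; have := h i ord0; rewrite mxE.
  by move=> h; split => // i j; rewrite (ord1 j) mxE; exact: h.
apply: fin_bigcap_measurable => // i _.
apply: (measurable_preimage (f := fun y : Rm m => tnth y i) (A := ball (q i ord0) e)).
  exact: measurable_tnth.
exact: measurable_ball.
Qed.

(** An open set is the union of the countably many balls with rational centre and radius that it
    contains, and sup-norm balls are products of intervals. *)
Lemma measurable_col_open m (O : set 'cV[R]_m) :
  open O -> measurable (@col_of_tuple R m @^-1` O).
Proof.
move=> oO.
pose B (u : 'cV[rat]_m * rat) : set 'cV[R]_m :=
  ball (map_mx (ratr : rat -> R) u.1) (ratr u.2).
pose F u : set (Rm m) :=
  if `[< B u `<=` O >] then @col_of_tuple R m @^-1` B u else set0.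
rewrite (_ : _ @^-1` _ = \bigcup_u F u); last first.
  apply/seteqP; split => y; last first.
    by move=> [u _]; rewrite /F; case: asboolP => // BO /BO.
  move=> /= Oy.
  have /nbhs_ballP[/= e e0 eO] : nbhs (col_of_tuple y) O.
    exact: open_nbhs_nbhs.
  (* With radius [s < e / 2] and a rational centre within [s] of the point, the ball stays within
     distance [2 s < e] of that point, hence in [O]. *)
  have /rat_in_itvoo[s] : 0 < e / 2 by rewrite divr_gt0.
  rewrite in_itv/= => /andP[s0 se].
  have h (i : 'I_m) : {q : rat | `|ratr q - col_of_tuple y i ord0| < ratr s}.
    apply/cid.
    have : col_of_tuple y i ord0 - ratr s < col_of_tuple y i ord0 + ratr s by lra.
    by move=> /rat_in_itvoo[q]; rewrite in_itv/= => qP; exists q; rewrite ltr_distl.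
  pose u : 'cV[rat]_m * rat := (\col_i sval (h i), s).
  have Buy : B u (col_of_tuple y).
    split => // i j; rewrite (ord1 j) /u /= mxE [X in ratr X]mxE.
    exact: (svalP (h i)).
  exists u => //; rewrite /F; case: asboolP => //; case => z Bz; apply: eO.
  apply: le_ball (ball_triangle (ball_sym Buy) Bz).
  by rewrite /=; lra.
apply: countable_bigcupT_measurable; first exact: countableP.
by move=> u; rewrite /F; case: asboolP => // _; exact: measurable_col_ball.
Qed.

Lemma measurable_col_closed m (A : set 'cV[R]_m) :
  closed A -> measurable (@col_of_tuple R m @^-1` A).
Proof.
move=> cA; have := measurableC (measurable_col_open (closed_openC cA)).
by rewrite -preimage_setC setCK.
Qed.

(** A feasible [w] is only continuous on the subspace [Psi], whence the relative form. The preimage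
    of an open interval is the trace on [D] of an open set. *)
Lemma measurable_col_within m (D : set 'cV[R]_m) (f : 'cV[R]_m -> R) :
  measurable (@col_of_tuple R m @^-1` D) -> {within D, continuous f} ->
  measurable_fun (@col_of_tuple R m @^-1` D)
    (fun y => f (col_of_tuple y) : measurableTypeR R).
Proof.
move=> mD /continuousP cf; apply: (measurability _ (RGenOpens.measurableE R)).
move=> _ [_ [a [b ->] <-]].
have oO : open (`]a, b[%classic : set R) by exact: interval_open.
have /open_subspaceP[V oV VD] := cf _ oO.
rewrite (_ : _ `&` _ = @col_of_tuple R m @^-1` D `&` @col_of_tuple R m @^-1` V).
  by apply: measurableI => //; exact: measurable_col_open.
rewrite -[RHS]preimage_setI [D `&` V]setIC VD setIC.
by [].
Qed.
End borel.

(** * Orthonormal frames of a hyperplane *)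

Section frames.
Context {R : realType} {m : nat}.
Implicit Types (theta : 'cV[R]_m.+1) (Z : 'M[R]_(m.+1, m)).

Lemma frameP theta Z : frame theta Z <->
  [/\ theta^T *m theta = 1%:M, theta^T *m Z = 0, Z^T *m theta = 0 & Z^T *m Z = 1%:M].
Proof.
rewrite /frame /orthogonal_group /= (tr_row_mx theta Z) (mul_col_row theta^T Z^T theta Z).
rewrite (@scalar_mx_block _ 1 m 1); split.
  by move=> /(@eq_block_mx _ 1 m 1 m) [].
by move=> [-> -> -> ->].
Qed.

Lemma frame_unit theta Z : frame theta Z -> sphere2 theta.
Proof. by move=> /frameP[h _ _ _]; apply/sphere2E; rewrite dotE h mxE. Qed.

(** A left inverse of a square matrix is a right inverse. The two terms are the orthogonal
    projections onto the line of [theta] and onto its complement. *)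
Lemma frame_sum theta Z : frame theta Z -> theta *m theta^T + Z *m Z^T = 1%:M.
Proof.
by move=> /mulmx1C; rewrite (tr_row_mx theta Z) (mul_row_col theta Z theta^T Z^T).
Qed.

(* The Householder reflection exchanging [theta] and the first basis vector. *)
Lemma frame_nonempty theta : sphere2 theta -> exists Z, frame theta Z.
Proof.
move=> /sphere2E th1.
pose e0 : 'cV[R]_m.+1 := delta_mx ord0 ord0.
(* The columns of such an [H] after the first form the frame, since its first column is [theta]. *)
suff [H HH He] : exists2 H : 'M[R]_m.+1, (H^T *m H = 1%:M)%R & (H *m e0 = theta)%R.
  exists (rsubmx (H : 'M[R]_(m.+1, 1 + m))).
  rewrite /frame /orthogonal_group /=.
  have -> : theta = lsubmx (H : 'M[R]_(m.+1, 1 + m)).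
    apply/colP => i; rewrite -He -colE !mxE; congr (H i _); exact/val_inj.
  by rewrite hsubmxK.
(* Here the reflection vector [theta - e0] vanishes, and the identity serves instead. *)
have [->|thN] := eqVneq theta e0.
  by exists 1%:M; rewrite ?trmx1 ?mul1mx.
pose v := theta - e0; pose c := dot v v.
have the0 : theta^T *m e0 = (theta ord0 ord0)%:M.
  by rewrite -colE; apply/matrixP => i j; rewrite !mxE !ord1 eqxx.
have e0e0 : e0^T *m e0 = 1%:M.
  by rewrite -colE; apply/matrixP => i j; rewrite !mxE !ord1.
have e0th : e0^T *m theta = (theta ord0 ord0)%:M.
  by rewrite -[LHS]trmxK trmx_mul trmxK the0 tr_scalar_mx.
have thth : theta^T *m theta = 1%:M.
  by rewrite [LHS]mx11_scalar -dotE th1.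
have vT : v^T = theta^T - e0^T by rewrite /v linearB.
have vv : v^T *m v = (2 * (1 - theta ord0 ord0))%:M.
  rewrite vT /v mulmxBl !mulmxBr thth the0 e0e0 e0th -!raddfB /=.
  by congr (_%:M); ring.
have cE : c = 2 * (1 - theta ord0 ord0) by rewrite /c dotE vv mxE.
have cN0 : c != 0.
  apply: contra thN => /eqP c0; rewrite -subr_eq0; apply/eqP/colP => i.
  have /eqP := c0; rewrite psumr_eq0; last by move=> j _; rewrite -expr2 sqr_ge0.
  move=> /allP/(_ i (mem_index_enum _)) /=; rewrite mulf_eq0 orbb => /eqP vi.
  by rewrite [RHS]mxE -vi.
have tN : 1 - theta ord0 ord0 != 0.
  by apply: contraNneq cN0 => h; rewrite cE h mulr0.
pose P := v *m v^T.
have PT : P^T = P by rewrite /P trmx_mul trmxK.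
have PP : P *m P = c *: P.
  by rewrite /P -mulmxA (mulmxA v^T) vv -cE mul_scalar_mx -scalemxAr.
have ve0 : v^T *m e0 = (theta ord0 ord0 - 1)%:M.
  by rewrite vT mulmxBl the0 e0e0 -raddfB.
have Pe0 : P *m e0 = (theta ord0 ord0 - 1) *: v.
  by rewrite /P -mulmxA ve0 mul_mx_scalar.
exists (1%:M - (2 / c) *: P).
  have -> : (1%:M - (2 / c) *: P)^T = 1%:M - (2 / c) *: P.
    by rewrite [LHS]linearB /= [X in _ - X]linearZ /= PT trmx1.
  rewrite mulmxBl mul1mx mulmxBr mulmx1 -scalemxAl -scalemxAr PP !scalerA.
  rewrite -scalerBl -addrA -opprD -scalerDl.
  rewrite (_ : 2 / c + _ = 0) ?scale0r ?subr0//.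
  by field.
rewrite mulmxBl mul1mx -scalemxAl Pe0 scalerA cE.
rewrite (_ : _ / _ * _ = -1) ?scaleN1r ?opprK.
  by rewrite /v addrCA subrr addr0.
by field.
Qed.

(** Put [U = Z^T *m Z']. The projection [Z *m Z^T] fixes the columns of [Z'], so [Z' = Z *m U] and
    [U] is orthogonal; rotation invariance concludes. *)
Lemma frame_volume theta Z Z' (v : 'cV[R]_m.+1) (A : set 'cV[R]_m.+1) :
  frame theta Z -> frame theta Z' ->
  measurable [set y : m.-tuple (measurableTypeR R) | A (v + Z *m col_of_tuple y)] ->
  lebesgue_tuple R m [set y | A (v + Z' *m col_of_tuple y)] =
  lebesgue_tuple R m [set y | A (v + Z *m col_of_tuple y)].
Proof.
move=> fZ fZ' mA.
have sZ := frame_sum fZ.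
have /frameP[_ _ Z't Z'Z'] := fZ'.
have /frameP[_ tZ Zt ZZ] := fZ.
have ZZ' : Z *m (Z^T *m Z') = Z'.
  rewrite mulmxA (_ : Z *m Z^T = 1%:M - theta *m theta^T); last first.
    by rewrite -sZ addrC addKr.
  rewrite mulmxBl mul1mx -mulmxA (_ : theta^T *m Z' = 0) ?mulmx0 ?subr0//.
  by rewrite -[LHS]trmxK trmx_mul trmxK Z't trmx0.
have UU : (Z^T *m Z')^T *m (Z^T *m Z') = 1%:M.
  by rewrite trmx_mul trmxK -mulmxA ZZ'.
rewrite -(lebesgue_tuple_rotation UU mA).
congr (lebesgue_tuple R m _); apply: eq_set => y.
by rewrite /= tuple_of_colK mulmxA ZZ'.
Qed.
End frames.

(** * Continuity and compactness for matrices *)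

Section mx_topology.
Context {R : realType}.

Lemma mx_continuous (T : topologicalType) a b (f : T -> 'M[R]_(a, b)) :
  (forall i j, continuous (fun x => f x i j)) -> continuous f.
Proof.
move=> cf x A [P PN PA].
have : \forall x' \near x, forall ij : 'I_a * 'I_b, P ij.1 ij.2 (f x' ij.1 ij.2).
  by apply: filter_forall => -[i j] /=; exact: (cf i j x _ (PN i j)).
by apply: filterS => x' h; apply: PA => i j; exact: (h (i, j)).
Qed.

Lemma entry_continuous (T : topologicalType) a b (f : T -> 'M[R]_(a, b)) i j :
  continuous f -> continuous (fun x => f x i j).
Proof.
by move=> cf x; exact: (continuous_comp (cf x) (@coord_continuous _ _ _ i j (f x))).
Qed.

Lemma mulmx_continuous (T : topologicalType) a b c (f : T -> 'M[R]_(a, b))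
    (g : T -> 'M[R]_(b, c)) :
  continuous f -> continuous g -> continuous (fun x => f x *m g x).
Proof.
move=> cf cg; apply: mx_continuous => i j.
under eq_fun do rewrite mxE.
have ff k : continuous (fun x => f x i k).
  exact: entry_continuous.
have gg k : continuous (fun x => g x k j).
  exact: entry_continuous.
apply: continuous_big => [|k _ x]; first exact: add_continuous.
by apply: cvgM; [exact: ff|exact: gg].
Qed.

Lemma trmx_continuous (T : topologicalType) a b (f : T -> 'M[R]_(a, b)) :
  continuous f -> continuous (fun x => (f x)^T).
Proof.
move=> cf; apply: mx_continuous => i j.
under eq_fun do rewrite mxE.
exact: entry_continuous.
Qed.

(** The box is the image under the continuous [vec_mx] of a finite power of a segment. *)
Lemma mx_box_compact a b (c : R) :
  compact [set A : 'M[R]_(a, b) | forall i j, `|A i j| <= c].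
Proof.
have cK : compact
    [set v : 'rV[R]_(a * b) | forall i, `[- c, c]%classic (v ord0 i)].
  apply: (rV_compact (A := fun=> `[- c, c]%classic)) => _.
  exact: segment_compact.
have cv : continuous (@vec_mx R a b).
  apply: mx_continuous => i j.
  rewrite (_ : (fun _ => _) = (fun v : 'rV[R]_(a * b) => v ord0 (mxvec_index i j))).
    exact: coord_continuous.
  by apply/funext => v; rewrite mxE.
have := continuous_compact (continuous_subspaceT cv) cK.
congr compact; apply/seteqP; split => A.
  move=> [v vc <-] i j; rewrite mxE ler_norml.
  by have := vc (mxvec_index i j); rewrite /= in_itv.
move=> Ac; exists (mxvec A); last exact: mxvecK.
move=> k /=; rewrite in_itv/= -ler_norml.
by case/mxvec_indexP : k => i j; rewrite mxvecE.
Qed.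
End mx_topology.

(** * Compactness of the parameter space and of Euclidean balls *)

Section Omega.
Context {R : realType} {m : nat}.
Implicit Types (theta : 'cV[R]_m.+1) (Z : 'M[R]_(m.+1, m)).

(** Each column of [A] has Euclidean norm 1. *)
Lemma ortho_coord a b (A : 'M[R]_(a, b)) i j : A^T *m A = 1%:M -> `|A i j| <= 1.
Proof.
move=> AA; rewrite -ler_sqr ?nnegrE// real_normK ?num_real// expr1n.
have := congr1 (fun B : 'M[R]_(b) => B j j) AA.
rewrite !mxE eqxx => /= /esym e; rewrite [leRHS]e.
under eq_bigr do rewrite mxE -expr2.
by rewrite (bigD1 i)//= lerDl; apply: sumr_ge0 => k _; rewrite sqr_ge0.
Qed.

(** Orthogonality is a closed equation which bounds all entries by 1, so it cuts [OmegaZ] out of the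
    compact box [K]; the unit length of [theta] is one of its blocks. *)
Lemma OmegaZ_compact (r : R) : compact (@OmegaZ R m r).
Proof.
pose K := [set A : 'cV[R]_m.+1 | forall i j, `|A i j| <= 1]
  `*` `[- r, r]%classic `*` [set A : 'M[R]_(m.+1, m) | forall i j, `|A i j| <= 1].
have cK : compact K.
  by do 2?apply: compact_setX; try exact: mx_box_compact; exact: segment_compact.
pose F (p : 'cV[R]_m.+1 * R * 'M[R]_(m.+1, m)) : 'M[R]_(1 + m) := row_mx p.1.1 p.2.
have cF : continuous F.
  apply: mx_continuous => i j; rewrite /F.
  case: (split_ordP j) => k ->.
    under eq_fun do rewrite row_mxEl.
    apply: entry_continuous => x.
    by apply: (continuous_comp (f := fst) (g := fst)); exact: cvg_fst.
  under eq_fun do rewrite row_mxEr.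
  by apply: entry_continuous => x; exact: cvg_snd.
rewrite (_ : OmegaZ r = K `&` (fun p => (F p)^T *m F p) @^-1` [set 1%:M]).
  apply: compact_closedI => //.
  apply: closed_comp => [p _|]; last first.
    by apply/accessible_closed_set1/hausdorff_accessible; exact: norm_hausdorff.
  exact: (mulmx_continuous (trmx_continuous cF) cF).
apply/seteqP; split => -[[theta t] Z] /=.
  move=> [/= th tr fZ]; split; last exact: fZ.
  have /frameP[tt _ _ ZZ] := fZ.
  split; [split|] => //=.
  - by move=> i j; exact: ortho_coord.
  - by move=> i j; exact: ortho_coord.
move=> [[[/= _ tr] _] fZ]; split => //=.
exact: (@frame_unit _ _ theta Z).
Qed.

Lemma ball2_compact n (r : R) : 0 <= r -> compact (@ball2 R n r).
Proof.
move=> r0.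
have h : (@ball2 R n r) = [set A : 'cV[R]_n | forall i j, `|A i j| <= r] `&`
   (fun y => (y^T *m y) ord0 ord0) @^-1` [set x | x <= r ^+ 2].
  apply/seteqP; split => y; last by move=> [_ /=]; rewrite -dotE => /(ball2E _ r0).
  move=> yr; split; last by rewrite /= -dotE; exact/(ball2E _ r0).
  by move=> i j; rewrite (ord1 j); exact: ball2_coord.
rewrite h; apply: compact_closedI; first exact: mx_box_compact.
apply: closed_comp => [y _|]; last exact: closed_le.
apply: entry_continuous.
by apply: mulmx_continuous; [apply: trmx_continuous|]; move=> ?; exact: cvg_id.
Qed.
End Omega.

(** * Slabs around slices and their uniform smallness *)

Section slabs.
Context {R : realType} {m : nat}.
Local Notation Rm := (m.-tuple (measurableTypeR R)).
Local Notation mu := (lebesgue_tuple R m).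
Local Notation param := ('cV[R]_m.+1 * R * 'M[R]_(m.+1, m))%type.
Implicit Types (p : param) (L : set 'cV[R]_m.+1).

(** For [p] in [OmegaZ] this is an isometric chart of the hyperplane [theta . x = t]. *)
Definition hyperplane_pt p (y : 'cV[R]_m) : 'cV[R]_m.+1 :=
  p.1.2 *: p.1.1 + p.2 *m y.

Lemma hyperplane_pt_continuous (T : topologicalType) (f : T -> param)
    (g : T -> 'cV[R]_m) : continuous f -> continuous g ->
  continuous (fun x => hyperplane_pt (f x) (g x)).
Proof.
move=> cf cg.
have c1 : continuous (fun x => (f x).1).
  by move=> x; apply: (continuous_comp (cf x)); exact: cvg_fst.
have c2 : continuous (fun x => (f x).1.1).
  by move=> x; apply: (continuous_comp (c1 x)); exact: cvg_fst.
have c3 : continuous (fun x => (f x).1.2).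
  by move=> x; apply: (continuous_comp (c1 x)); exact: cvg_snd.
have c4 : continuous (fun x => (f x).2).
  by move=> x; apply: (continuous_comp (cf x)); exact: cvg_snd.
move=> x; apply: cvgD; first by apply: cvgZ; [exact: c3|exact: c2].
exact: (mulmx_continuous c4 cg).
Qed.

Lemma hyperplane_pt_continuousr p : continuous (hyperplane_pt p).
Proof.
exact: (hyperplane_pt_continuous (f := fun=> p) (g := id)
  (@cst_continuous _ _ p) (fun y => cvg_id)).
Qed.

(** Joint continuity gives the estimate locally in [y]; compactness of the ball makes one
    neighbourhood of [p0] serve every [y]. *)
Lemma hyperplane_pt_near (r e : R) p0 : 0 <= r -> 0 < e ->
  \forall p \near p0, forall y, ball2 r y ->
    ball (hyperplane_pt p0 y) e (hyperplane_pt p y).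
Proof.
move=> r0 e0.
have /compact_near_coveringP/(_ _ (nbhs p0)
  (fun p y => ball (hyperplane_pt p0 y) e (hyperplane_pt p y))) := @ball2_compact R m r r0.
apply => y _ /=.
(* The points at [(p0, y')] and [(p, y')] are compared through the one at [(p0, y)], each within
   [e / 2] of it. *)
have e20 : 0 < e / 2 by rewrite divr_gt0.
have cq : continuous (fun q : param * 'cV[R]_m => hyperplane_pt q.1 q.2).
  by apply: hyperplane_pt_continuous => q; [exact: cvg_fst|exact: cvg_snd].
have h := cq (p0, y) _ (nbhsx_ballx (hyperplane_pt p0 y) (e / 2) e20).
case: h => -[A B] /= [pA yB] AB.
exists (B, A) => //= -[y' p] /= [By' Ap].
rewrite [e]splitr; apply: ball_triangle (AB (p, y') _); last by [].
apply: ball_sym; apply: (AB (p0, y')); split => //=.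
exact: nbhs_singleton.
Qed.

Definition thicken L (e : R) : set 'cV[R]_m.+1 := \bigcup_(a in L) ball a e.

Lemma thicken_open L e : open (thicken L e).
Proof.
have [e0|e0] := ltP 0 e; first by apply: bigcup_open => a _; exact: ball_open.
rewrite (_ : thicken L e = set0); first exact: open0.
by apply/seteqP; split => // x [a _ [/=]]; rewrite ltNge e0.
Qed.

Lemma sub_thicken L e : 0 < e -> L `<=` thicken L e.
Proof. by move=> e0 x Lx; exists x => //; exact: ballxx. Qed.

Lemma thicken_ball L e e' x x' :
  thicken L e x -> ball x e' x' -> thicken L (e + e') x'.
Proof. by move=> [a La ax] xx'; exists a => //; exact: ball_triangle ax xx'. Qed.

Lemma le_thicken L e e' : e <= e' -> thicken L e `<=` thicken L e'.
Proof. by move=> ee' x [a La ax]; exists a => //; exact: le_ball ax. Qed.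

(** A point of every thickening has points of [L] arbitrarily close, so it lies in the closure of
    [L]. *)
Lemma bigcap_thicken L : closed L -> \bigcap_k thicken L k.+1%:R^-1 = L.
Proof.
move=> cL; apply/seteqP; split => x; last first.
  by move=> Lx k _; apply: sub_thicken => //; rewrite invr_gt0.
move=> h; apply: cL => A /nbhs_ballP[e /= e0 eA].
have [N _ /(_ N (leqnn N)) Ne] := near_infty_natSinv_lt (PosNum e0).
have [a La ax] := h N I; exists a; split => //; apply: eA.
by apply: ball_sym; apply: le_ball ax; exact: ltW.
Qed.

(** The restriction to the ball gives finite measure, as continuity from above requires, and the
    range of [y] in which [hyperplane_pt_near] is uniform. *)
Definition slab (r : R) L e p : set Rm :=
  tball r `&` [set y | thicken L e (hyperplane_pt p (col_of_tuple y))].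

Lemma measurable_hyperplane_preimage p (O : set 'cV[R]_m.+1) : open O ->
  measurable [set y : Rm | O (hyperplane_pt p (col_of_tuple y))].
Proof.
move=> oO; apply: (@measurable_col_open R m (hyperplane_pt p @^-1` O)).
by apply: open_comp oO => y _; exact: hyperplane_pt_continuousr.
Qed.

Lemma measurable_slab r L e p : 0 <= r -> measurable (slab r L e p).
Proof.
move=> r0; apply: measurableI; first exact: measurable_tball.
by apply: measurable_hyperplane_preimage; exact: thicken_open.
Qed.

Lemma measurable_slice p L : closed L ->
  measurable [set y : Rm | L (hyperplane_pt p (col_of_tuple y))].
Proof.
move=> cL; apply: (@measurable_col_closed R m (hyperplane_pt p @^-1` L)).
by apply: closed_comp cL => y _; exact: hyperplane_pt_continuousr.
Qed.

(** Continuity from above: the slabs decrease to the part of the slice in the ball, and the first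
    one has finite measure. *)
Lemma slab_small (r : R) L p (g : \bar R) : 0 < r -> closed L ->
  (mu [set y | L (hyperplane_pt p (col_of_tuple y))] < g)%E ->
  exists k, (mu (slab r L k.+1%:R^-1 p) < g)%E.
Proof.
move=> r0 cL Lg.
pose F k := slab r L k.+1%:R^-1 p.
have mF k : measurable (F k) by exact: measurable_slab (ltW r0).
have FE : \bigcap_k F k = tball r `&` [set y | L (hyperplane_pt p (col_of_tuple y))].
  rewrite /F /slab bigcapIr; last by exists 0%N.
  congr (_ `&` _); rewrite -[in RHS](bigcap_thicken cL).
  by apply/seteqP; split.
have cv : mu (F k) @[k --> \oo] --> mu (\bigcap_k F k).
  apply: nonincreasing_cvg_mu => //.
  - have /andP[_ h] := lebesgue_tuple_tball m r0; apply: le_lt_trans h.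
    apply: le_measure; rewrite ?inE//; first exact: measurable_tball (ltW r0).
    by move=> y [].
  - exact: bigcapT_measurable.
  - move=> i j ij; apply/subsetPset => y [yr yL]; split => //.
    by apply: le_thicken yL; rewrite lef_pV2 ?posrE// ler_nat.
have lg : (mu (\bigcap_k F k) < g)%E.
  apply: le_lt_trans Lg; rewrite FE; apply: le_measure; rewrite ?inE.
  - apply: measurableI; first exact: measurable_tball (ltW r0).
    exact: measurable_slice.
  - exact: measurable_slice.
  - by move=> y [].
have [k _ /(_ k (leqnn k)) h] :=
  cv [set x | x < g]%E (open_nbhs_nbhs (conj (@open_ereal_lt_ereal _ g) lg)).
by exists k.
Qed.

(** A slab at a parameter near [p0] lies in a wider slab at [p0], so smallness at [p0] spreads to a
    neighbourhood; compactness of [OmegaZ] then gives a common [k]. *)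
Lemma slab_small_uniform (r : R) L (g : \bar R) : 0 < r -> closed L ->
  (forall p, OmegaZ r p -> mu [set y | L (hyperplane_pt p (col_of_tuple y))] < g)%E ->
  exists k, forall p, OmegaZ r p -> (mu (slab r L k.+1%:R^-1 p) < g)%E.
Proof.
move=> r0 cL Lg.
suff [k _ /(_ k (leqnn k)) h] : \forall k \near \oo, forall p, OmegaZ r p ->
    (mu (slab r L k.+1%:R^-1 p) < g)%E by exists k.
have /compact_near_coveringP/(_ _ \oo
    (fun k p => (mu (slab r L k.+1%:R^-1 p) < g)%E)) :=
  @OmegaZ_compact R m r.
apply => p0 /Lg /(slab_small r0 cL)[k0 k0g] /=.
(* Half of the width at [p0] absorbs the change of parameter, the other half is left for the slab at
   [p]. *)
have d0 : 0 < (k0.+1%:R^-1 : R) / 2 by rewrite divr_gt0 ?invr_gt0.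
exists ([set p | forall y, ball2 r y ->
    ball (hyperplane_pt p0 y) (k0.+1%:R^-1 / 2) (hyperplane_pt p y)],
  [set k | k.+1%:R^-1 < (k0.+1%:R^-1 : R) / 2]).
  split => /=; first exact: hyperplane_pt_near (ltW r0) d0.
  exact: near_infty_natSinv_lt (PosNum d0).
move=> -[p k] /= [hp hk]; apply: le_lt_trans k0g.
apply: le_measure; rewrite ?inE; [exact: measurable_slab (ltW r0)..|].
move=> y [yr yL]; split => //.
have := thicken_ball yL (ball_sym (hp _ yr)).
by apply: le_thicken; rewrite [leRHS]splitr lerD2r ltW.
Qed.
End slabs.

(** With the parameter fixed in [OmegaZ], it makes a function in C(Psi) continuous in [y] on the
    ball, hence measurable there. *)
Lemma within_continuous_section (U V W : topologicalType) (A : set U) (B : set V)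
    (u : U) (f : U * V -> W) :
  A u -> {within A `*` B, continuous f} ->
  {within B, continuous (fun v => f (u, v))}.
Proof.
move=> Au /subspace_continuousP cf; apply/subspace_continuousP => v Bv N fN.
have pc : continuous (fun v : V => (u, v)).
  by move=> z; apply: cvg_pair; [exact: cvg_cst|exact: cvg_id].
have H : nbhs v [set z | (A `*` B) (u, z) -> N (f (u, z))].
  exact: (pc v _ (cf (u, v) (conj Au Bv) N fN)).
have H' : nbhs v [set z | B z -> N (f (u, z))].
  by apply: filterS H => z h Bz; exact: (h (conj Au Bz)).
exact: H'.
Qed.

(** * Weak and strong duality *)

Section duality.
Context {R : realType} {m : nat}.
Local Notation Rm := (m.-tuple (measurableTypeR R)).
Local Notation mu := (lebesgue_tuple R m).
Local Notation param := ('cV[R]_m.+1 * R * 'M[R]_(m.+1, m))%type.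
Implicit Types (p : param) (L : set 'cV[R]_m.+1).

Lemma dot_hyperplane_pt theta t Z (y : 'cV[R]_m) : frame theta Z ->
  dot theta (hyperplane_pt (theta, t, Z) y) = t.
Proof.
move=> /frameP[tt tZ _ _]; rewrite dotE /hyperplane_pt /= mulmxDr mulmxA tZ mul0mx.
by rewrite addr0 -scalemxAr tt mxE mxE mulr1.
Qed.

(** Pythagoras: [frame_sum] splits the point into its components [t] along [theta] and [y] along
    [Z]. *)
Lemma norm_hyperplane_pt theta t Z (y : 'cV[R]_m) : frame theta Z ->
  let x := hyperplane_pt (theta, t, Z) y in dot x x = t ^+ 2 + dot y y.
Proof.
move=> fZ x; have /frameP[tt tZ Zt ZZ] := fZ.
have xE : x = t *: theta + Z *m y by [].
have e1 : theta^T *m x = t%:M.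
  by rewrite xE mulmxDr mulmxA tZ mul0mx addr0 -scalemxAr tt scalemx1.
have e2 : Z^T *m x = y.
  by rewrite xE mulmxDr mulmxA ZZ mul1mx -scalemxAr Zt scaler0 add0r.
have xx : x^T *m x =
    (theta^T *m x)^T *m (theta^T *m x) + (Z^T *m x)^T *m (Z^T *m x).
  rewrite -[X in _ *m X = _]mul1mx -(frame_sum fZ) mulmxDl mulmxDr.
  by rewrite !trmx_mul !trmxK !mulmxA.
rewrite !dotE xx e1 e2 mxE; congr (_ + _).
by rewrite tr_scalar_mx mul_scalar_mx scale_scalar_mx mxE eqxx mulr1n expr2.
Qed.

(** By Pythagoras the chart coordinate is no longer than the point, so the domain of integration in
    [Lambda] misses no part of the slice. *)
Lemma slice_tball r theta t Z L : 0 <= r -> L `<=` ball2 r -> frame theta Z ->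
  [set y : Rm | L (hyperplane_pt (theta, t, Z) (col_of_tuple y))] `<=` tball r.
Proof.
move=> r0 Lr fZ y /= /Lr /(ball2E _ r0); rewrite norm_hyperplane_pt// => h.
by apply/(ball2E _ r0); apply: le_trans h; rewrite lerDr sqr_ge0.
Qed.

(** Replaces the frame chosen in [hyperplane_vol] by an arbitrary one. The equation
    [dot theta x = t] holds along the whole chart, so only membership in [L] remains. *)
Lemma hyperplane_volE theta t Z L : closed L -> frame theta Z ->
  hyperplane_vol theta t (slice L theta t) =
  mu [set y | L (hyperplane_pt (theta, t, Z) (col_of_tuple y))].
Proof.
move=> cL fZ; rewrite /hyperplane_vol; set Z' := xget 0 (frame theta).
have fZ' : frame theta Z' by apply: (xgetPex 0); exists Z.
rewrite -[RHS](frame_volume (v := t *: theta) (A := L) fZ fZ'); last first.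
  exact: (measurable_slice (theta, t, Z) cL).
congr (mu _); apply/seteqP; split => y /=; first by case.
by move=> Ly; split => //; exact: (dot_hyperplane_pt t _ fZ').
Qed.

Lemma weak_duality r L g w : 0 < r -> compact L -> L `<=` ball2 r ->
  @feasible R m r L g w ->
  forall theta t, sphere2 theta -> - r <= t <= r ->
  (hyperplane_vol theta t (slice L theta t) <= g%:E)%E.
Proof.
move=> r0 cL Lr [cw Lw w1 w0] theta t th tr.
have {}cL : closed L by apply: compact_closed cL; exact: norm_hausdorff.
have [Z fZ] := frame_nonempty th.
rewrite (hyperplane_volE t cL fZ).
pose p := (theta, t, Z); have Op : OmegaZ r p by [].
apply: le_trans (Lw _ Op).
pose S := [set y : Rm | L (hyperplane_pt p (col_of_tuple y))].
have mS : measurable S by exact: measurable_slice.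
have St : S `<=` tball r by apply: slice_tball => //; exact: ltW.
(* Since the slice lies in the ball, its volume is the integral over the ball of an indicator, to be
   compared with [w] pointwise. *)
rewrite -[X in (X <= _)%E](_ : \int[mu]_(y in tball r) (\1_S y)%:E = _)%E; last first.
  rewrite integral_indic//; last exact: measurable_tball (ltW r0).
  by congr (mu _); exact/setIidl.
have mB : measurable (tball r : set Rm) by exact: measurable_tball (ltW r0).
apply: ge0_le_integral => //.
- by apply/measurable_EFinP; exact: measurable_indic.
- apply/measurable_EFinP.
  apply: (@measurable_col_within R m (ball2 r) (fun y => w (p, y))) => //.
  exact: within_continuous_section Op cw.
- move=> y By; rewrite lee_fin indicE; have [yS|yS] := pselect (S y).
    by rewrite mem_set//; apply: w1.
  by rewrite memNset//; apply: w0.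
Qed.

(** The strict inequality leaves room to widen each slice to a slab, after which
    [slab_small_uniform] fixes a common width. *)
Lemma strong_duality r L (g : R) : 0 < r -> compact L ->
  (forall theta t, sphere2 theta -> - r <= t <= r ->
    (hyperplane_vol theta t (slice L theta t) < g%:E)%E) ->
  exists w, @feasible R m r L g w.
Proof.
move=> r0 cL Lg.
have {}cL : closed L by apply: compact_closed cL; exact: norm_hausdorff.
have [k kg] : exists k, forall p, OmegaZ r p ->
    (mu (slab r L k.+1%:R^-1 p) < g%:E)%E.
  apply: slab_small_uniform => // -[[theta t] Z] [/= th tr fZ].
  by rewrite -(hyperplane_volE t cL fZ); exact: Lg.
pose N := thicken L (k.+1%:R^-1).
have LN : L `<=` N by apply: sub_thicken; rewrite invr_gt0.
(* The closed complement of [N] and the closed [L] are disjoint, so normality of the pseudometric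
   space separates them. *)
have sep : uniform_separator (~` N) L.
  apply: (normal_uniform_separator (pseudometric_normal (R := R))) => //.
    by apply: open_closedC; exact: thicken_open.
  by rewrite setIC; apply/disjoints_subset; rewrite setCK.
pose f : 'cV[R]_m.+1 -> R := Urysohn (~` N) L.
have cf : continuous f by exact: Urysohn_continuous.
have f01 x : 0 <= f x <= 1.
  have : range f (f x) by exists x.
  by move=> /Urysohn_range; rewrite /= in_itv.
have f0 x : ~ N x -> f x = 0 by move=> Nx; apply: (Urysohn_sub0 sep); exists x.
have f1 x : L x -> f x = 1 by move=> Nx; apply: (Urysohn_sub1 sep); exists x.
have mB : measurable (tball r : set Rm) by exact: measurable_tball (ltW r0).
have ch : continuous (fun q : param * 'cV[R]_m => hyperplane_pt q.1 q.2).
  by apply: hyperplane_pt_continuous => q; [exact: cvg_fst|exact: cvg_snd].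
exists (fun q => f (hyperplane_pt q.1 q.2)); split.
- apply: continuous_subspaceT => q.
  by apply: (continuous_comp (ch q)); exact: cf.
- move=> p Op; apply: le_trans (ltW (kg _ Op)).
  have mS : measurable (slab r L k.+1%:R^-1 p) by exact: measurable_slab (ltW r0).
  have -> : (mu (slab r L k.+1%:R^-1 p) =
      \int[mu]_(y in tball r) (\1_(slab r L k.+1%:R^-1 p) y)%:E)%E.
    by rewrite integral_indic//; congr (mu _); apply/esym/setIidl => y [].
  apply: ge0_le_integral => //.
  + by move=> y _; rewrite lee_fin; case/andP: (f01 (hyperplane_pt p (col_of_tuple y))).
  + apply/measurable_EFinP.
    apply: (@measurable_col_within R m (ball2 r) (fun y => f (hyperplane_pt p y))) => //.
    apply: continuous_subspaceT => y.
    exact: (continuous_comp (@hyperplane_pt_continuousr R m p y) (cf _)).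
  + by apply/measurable_EFinP; exact: measurable_indic.
  + move=> y By; rewrite lee_fin indicE.
    have [yS|yS] := pselect (slab r L k.+1%:R^-1 p y).
      by rewrite mem_set//; case/andP: (f01 (hyperplane_pt p (col_of_tuple y))).
    (* In the ball but off the slab, the point lies outside [N], where [f] vanishes. *)
    by rewrite memNset// f0// => Ny; apply: yS.
- by move=> q [_ /= Lq]; rewrite f1.
- by move=> q _; case/andP: (f01 (hyperplane_pt q.1 q.2)).
Qed.
End duality.

(** * Equality of the two optimal values *)

Unset Implicit Arguments.
Set Strict Implicit.
Set Printing Implicit Defensive.

Theorem theorem3p2 (R : realType) (m : nat) (r : R) (L : set 'cV[R]_m.+1)
    (r_gt0 : 0 < r) (L_compact : compact L) (L_ball : L `<=` ball2 r) :
  pstar r L = Pstar r L.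
Proof.
apply/eqP; rewrite eq_le; apply/andP; split; last first.
  apply: le_ereal_inf_tmp => _ [g [w fw] <-].
  apply: ge_ereal_sup => _ [[theta t] [/= th tr] <-].
  exact: (weak_duality r_gt0 L_compact L_ball fw).
have vol_le theta t : sphere2 theta -> - r <= t <= r ->
    (hyperplane_vol theta t (slice L theta t) <= Pstar r L)%E.
  by move=> th tr; apply: ereal_sup_ubound; exists (theta, t).
(* The central slice orthogonal to the first basis vector shows that the supremum is over a nonempty
   family, which excludes the value [-oo]. *)
have P0 : (0 <= Pstar r L)%E.
  apply: le_trans (vol_le (delta_mx ord0 ord0) 0 _ _); first exact: measure_ge0.
    apply/sphere2E; rewrite /dot (bigD1 ord0)//= big1 => [|i /negPf i0].
      by rewrite mxE eqxx mulr1 addr0.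
    by rewrite mxE i0 mul0r.
  by rewrite oppr_le0 ltW.
case: (Pstar r L) P0 vol_le => [s _ vol_le| _ _|//]; last exact: leey.
(* The slack [e] turns the bound by the supremum into the strict one required by
   [strong_duality]. *)
apply/lee_addgt0Pr => e e0.
have [|w fw] := @strong_duality R m r L (s + e) r_gt0 L_compact.
  move=> theta t th tr; apply: le_lt_trans (vol_le _ _ th tr) _.
  by rewrite lte_fin ltrDl.
by apply: ereal_inf_lbound; exists (s + e) => //; exists w.
Qed.
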